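(* Let $\mathcal H$ and $\mathcal G$ be real Hilbert spaces, let $z\in\mathcal H$, let $r\in\mathcal G$, let $f\colon\mathcal H\to\,]-\infty,+\infty]$ and $g\colon\mathcal G\to\,]-\infty,+\infty]$ be lower semicontinuous convex functions, and let $L\colon\mathcal H\to\mathcal G$ be a nonzero bounded linear operator such that $r\in\operatorname{sri}\big(L(\operatorname{dom}f)-\operatorname{dom}g\big)$. Consider the problems $$\underset{x\in\mathcal H}{\text{minimize}}\;\; f(x)+g(Lx-r)+\tfrac12\|x-z\|^2\qquad (P)$$ and $$\underset{v\in\mathcal G}{\text{minimize}}\;\;\widetilde{f^*}(z-L^*v)+g^*(v)+\langle v\mid r\rangle.\qquad (D)$$ Then $(D)$ is the dual of $(P)$ and it admits at least one solution. Moreover, every solution $v$ to $(D)$ is characterized by the inclusion $$L\big(\operatorname{prox}_f(z-L^*v)\big)-r\in\partial g^*(v),$$ that is, a point $v\in\mathcal G$ solves $(D)$ if and only if it satisfies this inclusion.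
   Context: For a function $\varphi$ with values in $]-\infty,+\infty]$, $\operatorname{dom}\varphi=\{x : \varphi(x)<+\infty\}$. For a nonempty convex set $C$ in a Hilbert space, $\operatorname{cone}C=\bigcup_{\lambda>0}\{\lambda x: x\in C\}$, and the strong relative interior is $\operatorname{sri}C=\{x\in C:\operatorname{cone}(C-x)=\overline{\operatorname{span}}(C-x)\}$, where $\overline{\operatorname{span}}$ is the closed linear span (and $\operatorname{sri}\varnothing=\varnothing$; thus the hypothesis implies that $f$ and $g$ are proper). For $\varphi$ proper, lower semicontinuous and convex on a real Hilbert space: $\varphi^*(u)=\sup_x\langle x\mid u\rangle-\varphi(x)$ is its conjugate; $\widetilde{\varphi}(x)=\min_y\varphi(y)+\frac12\|x-y\|^2$ is its Moreau envelope (so $\widetilde{f^*}$ is the Moreau envelope of $f^*$); $\operatorname{prox}_\varphi x$ is the unique minimizer of $y\mapsto\varphi(y)+\frac12\|x-y\|^2$; $\partial\varphi(x)=\{u:(\forall y)\ \langle y-x\mid u\rangle+\varphi(x)\le\varphi(y)\}$ is the subdifferential. $L^*$ denotes the adjoint of $L$. ''Dual'' is meant in the Fenchel-Moreau-Rockafellar sense: for proper lower semicontinuous convex functions $\varphi$ on $\mathcal H$ and $\psi$ on $\mathcal G$, and $M\colon\mathcal H\to\mathcal G$ bounded linear, the dual of the problem of minimizing $\varphi+\psi\circ M$ over $\mathcal H$ is the problem of minimizing $\varphi^*\circ(-M^* )+\psi^*$ over $\mathcal G$. Problem $(P)$ is viewed in this form with $\varphi=f+\frac12\|\cdot-z\|^2$,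 $\psi=g(\cdot-r)$ and $M=L$, and minimization problems whose objectives differ only by an additive constant are regarded as the same problem. *)

(* Defs.v *)
From HB Require Import structures.
From mathcomp Require Import all_boot all_order all_algebra.
From mathcomp Require Import all_classical all_reals all_analysis.

Set Implicit Arguments.
Unset Strict Implicit.
Unset Printing Implicit Defensive.

Import Order.TTheory GRing.Theory Num.Theory.
Import numFieldNormedType.Exports.

Local Open Scope classical_set_scope.
Local Open Scope ring_scope.
Local Open Scope ereal_scope.

(* A real Hilbert space: a complete normed space whose norm comes from a
   (bilinear, symmetric, positive definite) inner product. *)
HB.mixin Record CompleteNormedModule_isHilbert (R : realType) H
    & CompleteNormedModule R H := {
  inner : {dot H for @idfun R} ;
  inner_norm : forall x : H, (inner x x = `|x| ^+ 2)%R
}.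

#[short(type="hilbertType")]
HB.structure Definition Hilbert (R : realType) :=
  {H of CompleteNormedModule R H & CompleteNormedModule_isHilbert R H}.

Section Sets.
Context {R : realType} {H : hilbertType R}.
Implicit Types C D A : set H.

Definition set_sub C D : set H := [set (x - y)%R | x in C & y in D].

Definition cone C : set H :=
  \bigcup_(l in [set l : R | (0 < l)%R]) [set (l *: x)%R | x in C].

Definition linear_subspace A : Prop :=
  A 0%R /\ forall (a : R) x y, A x -> A y -> A (a *: x + y)%R.

Definition lin_span C : set H := smallest linear_subspace C.

Definition sri C : set H :=
  [set x | C x /\
    cone (set_sub C [set x]) = closure (lin_span (set_sub C [set x]))].

End Sets.

Section Functions.
Context {R : realType} {H : hilbertType R}.
Implicit Types phi : H -> \bar R.

Definition edom phi : set H := [set x | phi x < +oo].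

Definition econvex phi : Prop := forall x y (t : R), (0 < t < 1)%R ->
  phi (t *: x + (1 - t) *: y)%R <= t%:E * phi x + (1 - t)%:E * phi y.

Definition proper_fun phi : Prop :=
  (forall x, -oo < phi x) /\ edom phi !=set0.

Definition conjugate phi (u : H) : \bar R :=
  ereal_sup [set (inner x u)%:E - phi x | x in [set: H]].

Definition prox_objective phi (x y : H) : \bar R :=
  phi y + (2^-1 * `|x - y| ^+ 2)%:E.

Definition moreau_env phi (x : H) : \bar R :=
  ereal_inf [set prox_objective phi x y | y in [set: H]].

Definition argmin phi : set H := [set p | forall y, phi p <= phi y].

(* The default value 0 is irrelevant when phi is proper, lower semicontinuous
   and convex, since the minimizer then exists and is unique. *)
Definition prox phi (x : H) : H :=
  xget 0%R [set p | argmin (prox_objective phi x) = [set p]].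

Definition subdiff phi (x : H) : set H :=
  [set u | forall y, (inner (y - x)%R u)%:E + phi x <= phi y].

Definition same_problem phi phi' : Prop :=
  exists c : R, forall x, phi x = phi' x + c%:E.

End Functions.

Section Duality.
Context {R : realType} {H G : hilbertType R}.

(* By Riesz representation, the set below is a singleton when M is bounded. *)
Definition adjoint (M : {linear H -> G}) (v : G) : H :=
  xget 0%R [set u | forall x, inner (M x) v = inner x u].

(* The problem of minimizing D is the Fenchel-Moreau-Rockafellar dual of the
   problem of minimizing P, where P is split as phi + psi \o M. *)
Definition is_dual_of (phi : H -> \bar R) (psi : G -> \bar R)
    (M : {linear H -> G}) (P : H -> \bar R) (D : G -> \bar R) : Prop :=
  [/\ [/\ proper_fun phi, lower_semicontinuous phi & econvex phi],
      [/\ proper_fun psi, lower_semicontinuous psi & econvex psi],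
      bounded_near M (nbhs (0%R : H)),
      same_problem P (fun x => phi x + psi (M x))
    & same_problem D
        (fun v => conjugate phi (- adjoint M v)%R + conjugate psi v)].

Definition primal_objective (f : H -> \bar R) (g : G -> \bar R)
    (L : {linear H -> G}) (z : H) (r : G) (x : H) : \bar R :=
  f x + g (L x - r)%R + (2^-1 * `|x - z| ^+ 2)%:E.

Definition dual_objective (f : H -> \bar R) (g : G -> \bar R)
    (L : {linear H -> G}) (z : H) (r : G) (v : G) : \bar R :=
  moreau_env (conjugate f) (z - adjoint L v)%R + conjugate g v
  + (inner v r)%:E.

End Duality.

(* Main.v *)
(* The whole argument runs on [prox_exists]: a minimizing sequence of the
   strongly convex function f + |. - w|^2 / 2 is Cauchy by the parallelogram
   law, and its limit p satisfies w - p in the subdifferential of f at p.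
   Applied to indicators it yields projections, applied to linear forms the
   Riesz representation, and applied to f the Moreau identity
   (f + |. - z|^2 / 2)^* (u) = env (f^* ) (z + u) - |z|^2 / 2, which gives the
   duality.

   Existence of a dual solution is the Attouch-Brezis theorem.  The dual
   objective is a supremum of affine functions with slopes in
   K = L (dom f) - dom g - r.  It is invariant under translations orthogonal to
   V = closure (span K), and since cone K = V its sublevel sets are weakly
   bounded in V, hence bounded by Banach-Steinhaus.  Weak compactness is avoided:
   the least-norm points of a decreasing sequence of closed convex sets form a
   Cauchy sequence as soon as they are bounded.

   The characterization follows from env (f^* ) being differentiable with
   gradient prox f. *)

Require Import Defs.
From HB Require Import structures.
From mathcomp Require Import all_boot all_order all_algebra.
From mathcomp Require Import all_classical all_reals all_analysis.
From mathcomp Require Import ring lra.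

Set Implicit Arguments.
Unset Strict Implicit.
Unset Printing Implicit Defensive.

Import Order.TTheory GRing.Theory Num.Theory.
Import numFieldNormedType.Exports.

Local Open Scope classical_set_scope.
Local Open Scope ring_scope.
Local Open Scope ereal_scope.

(** * Inner product calculus, Cauchy-Schwarz, continuity and completeness *)

Section InnerProduct.
Context {R : realType} {H : hilbertType R}.
Implicit Types (x y z : H) (a : R).
Local Open Scope ring_scope.

Lemma innerC x y : inner x y = inner y x.
Proof. by rewrite hermC expr0 mul1r. Qed.

Lemma innerDr x y z : inner x (y + z) = inner x y + inner x z.
Proof. exact: linearDr. Qed.

Lemma innerNr x y : inner x (- y) = - inner x y.
Proof. exact: linearNr. Qed.

Lemma innerZr x a y : inner x (a *: y) = a * inner x y.
Proof. exact: linearZr_LR. Qed.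

Lemma inner0r x : inner x 0 = 0.
Proof. exact: linear0r. Qed.

Lemma innerDl x y z : inner (x + y) z = inner x z + inner y z.
Proof. by rewrite innerC innerDr !(innerC z). Qed.

Lemma innerNl x y : inner (- x) y = - inner x y.
Proof. by rewrite innerC innerNr innerC. Qed.

Lemma innerZl a x y : inner (a *: x) y = a * inner x y.
Proof. by rewrite innerC innerZr innerC. Qed.

Lemma inner0l x : inner 0 x = 0.
Proof. by rewrite innerC inner0r. Qed.

Definition innerE :=
  (innerDr, innerNr, innerZr, inner0r, innerDl, innerNl, innerZl, inner0l).

Lemma sqr_normD x y : `|x + y| ^+ 2 = `|x| ^+ 2 + 2 * inner x y + `|y| ^+ 2.
Proof. by rewrite -!inner_norm !innerE (innerC y x); ring. Qed.

Lemma sqr_normB x y : `|x - y| ^+ 2 = `|x| ^+ 2 - 2 * inner x y + `|y| ^+ 2.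
Proof. by rewrite -!inner_norm !innerE (innerC y x); ring. Qed.

Lemma sqr_normZ a x : `|a *: x| ^+ 2 = a ^+ 2 * `|x| ^+ 2.
Proof. by rewrite -!inner_norm !innerE; ring. Qed.

Lemma inner_le_norm x y : inner x y <= `|x| * `|y|.
Proof.
have [->|x0] := eqVneq x 0; first by rewrite inner0l normr0 mul0r.
have [->|y0] := eqVneq y 0; first by rewrite inner0r normr0 mulr0.
have xy : 0 < `|x| * `|y| by rewrite mulr_gt0 ?normr_gt0.
(* Expanded, this square is [2 * xy * (xy - inner x y)] with [xy] the product of the norms. *)
have := sqr_ge0 (Num.norm (`|y| *: x - `|x| *: y)).
rewrite sqr_normB !sqr_normZ !innerE => h.
rewrite -subr_ge0 -(pmulr_rge0 _ xy); nra.
Qed.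

Lemma norm_inner_le x y : `|inner x y| <= `|x| * `|y|.
Proof.
rewrite ler_norml inner_le_norm andbT lerNl -innerNr.
by rewrite -(normrN y) inner_le_norm.
Qed.

Lemma inner_linear x : linear (inner x).
Proof. by move=> a y z; rewrite innerDr innerZr. Qed.

Lemma inner_bounded x : bounded_fun_norm (inner x).
Proof.
move=> s; exists (`|x| * s) => y ys.
by rewrite (le_trans (norm_inner_le x y))// ler_wpM2l.
Qed.

Lemma cvg_inner {I : Type} {F : set_system I} {FF : Filter F}
    x (u : I -> H) p : u @ F --> p -> inner x (u i) @[i --> F] --> inner x p.
Proof.
move=> up; apply/cvgrPdist_le => e e0.
have x1 : 0 < `|x| + 1 by rewrite ltr_wpDl.
move/cvgrPdist_le : up => /(_ (e / (`|x| + 1))) h.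
near=> i; rewrite -innerNr -innerDr (le_trans (norm_inner_le _ _))//.
have : `|p - u i| <= e / (`|x| + 1) by near: i; apply: h; rewrite divr_gt0.
rewrite ler_pdivlMr// => h1.
have := normr_ge0 (p - u i); nra.
Unshelve. all: by end_near. Qed.

Lemma cvg_sqr_norm {I : Type} {F : set_system I} {FF : Filter F}
    (u : I -> H) p : u @ F --> p -> `|u i| ^+ 2 @[i --> F] --> `|p| ^+ 2.
Proof. by move=> up; rewrite !expr2; apply: cvgM; exact: cvg_norm. Qed.

(** Completeness in the form produced by the parallelogram law and by projections, which control
    squared distances. *)
Lemma cvg_sqr_cauchy (u : nat -> H) (e : nat -> R) : e @ \oo --> (0 : R) ->
  (forall n k, (n <= k)%N -> `|u k - u n| ^+ 2 <= e n) -> cvg (u @ \oo).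
Proof.
move=> e0 ue; apply/cauchy_cvgP/cauchy_exP => d d0.
have d2 : 0 < d ^+ 2 by rewrite exprn_gt0.
move/cvgrPdist_lt : e0 => /(_ _ d2)[N _ /(_ N (leqnn N))].
rewrite sub0r normrN => eN.
exists (u N); exists N => // k /= Nk; rewrite -ball_normE/= distrC.
rewrite -(@ltr_pXn2r _ 2)// ?nnegrE ?(ltW d0)//.
by rewrite (le_lt_trans (ue _ _ Nk))// (le_lt_trans (ler_norm _)).
Qed.

End InnerProduct.

(** * Convex lower semicontinuous functions and the proximity operator *)

Section Convex.
Context {R : realType} {H : hilbertType R}.
Implicit Types (f : H -> \bar R) (x y p w : H) (a b t : R).

Lemma econvex_le f x y a b t : econvex f -> (0 < t < 1)%R ->
  f x <= a%:E -> f y <= b%:E ->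
  f (t *: x + (1 - t) *: y)%R <= (t * a + (1 - t) * b)%:E.
Proof.
move=> cf t01 fa fb; apply: (le_trans (cf x y t t01)).
case/andP: t01 => t0 t1; rewrite (EFinD (t * a)%R) (EFinM t) (EFinM (1 - t)%R).
by apply: leeD; apply: lee_wpmul2l => //; rewrite lee_fin ?subr_ge0 ltW.
Qed.

(** Testing convexity on finite upper bounds only keeps infinite values out of the computations. *)
Lemma le_econvex f : (forall x, -oo < f x) ->
  (forall x y a b t, (0 < t < 1)%R -> f x <= a%:E -> f y <= b%:E ->
    f (t *: x + (1 - t) *: y)%R <= (t * a + (1 - t) * b)%:E) ->
  econvex f.
Proof.
move=> fNy h x y t t01; have /andP[t0 t1] := t01.
have t1' : (0 < 1 - t)%R by rewrite subr_gt0.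
case fx : (f x) (fNy x) => [a| |] // _; last first.
  rewrite gt0_muley ?lte_fin// addye ?leey//.
  case: (f y) (fNy y) => [b| |] // _.
  by rewrite gt0_muley ?lte_fin.
case fy : (f y) (fNy y) => [b| |] // _; last first.
  by rewrite gt0_muley ?lte_fin// -EFinM addey// leey.
by rewrite -!EFinM -EFinD; apply: h; rewrite ?fx ?fy.
Qed.

Lemma lsc_cvg_le f (u : nat -> H) p (c : nat -> R) l :
  lower_semicontinuous f -> u @ \oo --> p -> c @ \oo --> l ->
  (forall n, f (u n) <= (c n)%:E) -> f p <= l%:E.
Proof.
move=> lf up cl fuc; rewrite leNgt; apply/negP => lfp.
have [a la afp] : exists2 a : R, (l < a)%R & a%:E < f p.
  case: (f p) lfp => [b| |] //; last by move=> _; exists (l + 1)%R; rewrite ?ltrDl ?ltry.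
  rewrite lte_fin => lb; exists ((l + b) / 2)%R; rewrite ?lte_fin; lra.
have [V Vp afV] := lf _ _ afp.
have : \forall n \near \oo, (a <= c n)%R.
  near=> n; rewrite -lee_fin (le_trans _ (fuc n))// ltW// afV//.
  by near: n; exact: up.
move=> /(limr_ge (cvgP _ cl)); rewrite (cvg_lim _ cl)// => al.
by move: la; rewrite ltNge al.
Unshelve. all: by end_near. Qed.

(** Lower semicontinuity gives [f > f x0 - 1] on a ball around [x0]. Convexity along the segment
    from [x0] to a far [x] carries this bound outwards, with a loss linear in the distance. *)
Lemma convex_lsc_minorant f x0 : lower_semicontinuous f -> econvex f ->
  (forall x, -oo < f x) -> f x0 < +oo ->
  exists c k : R, forall x, (c - k * `|x - x0|)%:E <= f x.
Proof.
move=> lf cf fNy fy.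
have [a fa] : exists a, f x0 = a%:E.
  by exists (fine (f x0)); rewrite fineK// fin_real// fNy fy.
have [|V Vx0 afV] := lf x0 (a - 1)%R; first by rewrite fa lte_fin ltrBlDr ltrDl.
have /nbhs_normP[d /= d0 dV] := Vx0.
exists (a - 1)%R, (2 / d)%R => x.
have [xd|dx] := ltP `|x - x0|%R d.
  apply: ltW; apply: le_lt_trans (afV x _).
    by rewrite lee_fin lerBlDr lerDl mulr_ge0// divr_ge0// ltW.
  by apply: dV => /=; rewrite distrC.
have n0 : (0 < `|x - x0|)%R by exact: lt_le_trans dx.
case fx : (f x) (fNy x) => [b| |] // _; last by rewrite leey.
set n := `|x - x0|%R in dx n0 *.
(* This places the point of the segment at distance [d / 2] from [x0], inside the ball. *)
pose t := (d / (2 * n))%R.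
have tn : (t * n = d / 2)%R by rewrite /t; field; rewrite gt_eqF.
have t0 : (0 < t)%R by rewrite /t divr_gt0// mulr_gt0.
have t1 : (t < 1)%R by nra.
have : (a - 1)%:E < f (t *: x + (1 - t) *: x0)%R.
  apply: afV; apply: dV => /=; rewrite distrC.
  have -> : (t *: x + (1 - t) *: x0 - x0 = t *: (x - x0))%R.
    by rewrite scalerBl scale1r scalerBr addrA addrAC addrK.
  by rewrite normrZ gtr0_norm// -/n tn; lra.
have t01 : (0 < t < 1)%R by rewrite t0.
have fxb : f x <= b%:E by rewrite fx.
have fx0a : f x0 <= a%:E by rewrite fa.
move=> /lt_le_trans /(_ (econvex_le cf t01 fxb fx0a)).
rewrite lte_fin lee_fin => h.
have h1 : (-1 < t * (b - a))%R by lra.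
have -> : (2 / d * n = t^-1)%R by rewrite /t invf_div mulrAC.
have h2 : (t * t^-1 = 1)%R by rewrite divff// gt_eqF.
have h3 : (0 < t^-1)%R by rewrite invr_gt0.
nra.
Qed.

Lemma ge0_of_small a b :
  (forall t, 0 < t < 1 -> 0 <= a + t * b)%R -> (0 <= a)%R.
Proof.
move=> h; rewrite leNgt; apply/negP => a0.
have b0 : (0 <= `|b|)%R by [].
have d0 : (0 < 2 * (`|b| - a) + 1)%R by lra.
(* Chosen in the unit interval so that [t * |b| < - a / 2], which makes [a + t * b] negative. *)
pose t := (- a / (2 * (`|b| - a) + 1))%R.
have tE : (t * (2 * (`|b| - a) + 1) = - a)%R by rewrite divfK// gt_eqF.
have t0 : (0 < t)%R by rewrite divr_gt0// oppr_gt0.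
have t1 : (t < 1)%R by rewrite ltr_pdivrMr// mul1r; lra.
have := h t; rewrite t0 t1 => /(_ isT).
have : (t * b <= t * `|b|)%R by rewrite ler_pM2l// ler_norm.
nra.
Qed.

(** Strong convexity of the objective: the quadratic excess gives minimality of [p] and its
    uniqueness at once. *)
Lemma subdiff_prox f p w : subdiff f p (w - p)%R -> forall y,
  prox_objective f w p + (2^-1 * `|y - p| ^+ 2)%:E <= prox_objective f w y.
Proof.
move=> sp y; rewrite /prox_objective -addeA -EFinD.
apply: le_trans (leeD2r _ (sp y)).
rewrite [leRHS]addeAC addeC leeD2r// -EFinD lee_fin.
have -> : (w - y = (w - p) - (y - p))%R by rewrite opprB addrA subrK.
by rewrite [in leRHS]sqr_normB innerC; lra.
Qed.

Lemma proxE f p w : f p \is a fin_num -> subdiff f p (w - p)%R ->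
  prox f w = p.
Proof.
move=> fp sp.
have pE : argmin (prox_objective f w) = [set p].
  apply/seteqP; split => [q /(_ p) qp|q -> y] /=; last first.
    by apply: le_trans (subdiff_prox sp y); rewrite leeDl// lee_fin mulr_ge0.
  have := le_trans (subdiff_prox sp q) qp.
  rewrite -{2}[prox_objective f w p]adde0 leeD2lE//; last first.
    by rewrite fin_numD fp.
  rewrite lee_fin => h.
  by apply/eqP; rewrite -subr_eq0 -normr_eq0 -sqrf_eq0 eq_le sqr_ge0 andbT; lra.
rewrite /prox; case: xgetP => [q _ /= qE|/(_ p)//].
by have : [set p] q by rewrite -pE qE.
Qed.

Lemma prox_exists f w : lower_semicontinuous f -> econvex f ->
  proper_fun f -> exists2 p, f p \is a fin_num & subdiff f p (w - p)%R.
Proof.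
move=> lf cf [fNy [x0 /= fx0]].
have [c [k fck]] := convex_lsc_minorant lf cf fNy fx0.
(* The real upper bounds of values of the objective, so that its infimum [m] is taken in [R]. *)
pose A : set R := [set s : R | exists y, f y <= (s - 2^-1 * `|w - y| ^+ 2)%:E].
have An0 : A !=set0.
  exists (fine (f x0) + 2^-1 * `|w - x0| ^+ 2)%R; exists x0.
  by rewrite addrK fineK// fin_real// fNy fx0.
have [l Al] : exists l : R, lbound A l.
  (* The quadratic term absorbs the linear minorant, since [|k| * d <= d ^ 2 / 2 + |k| ^ 2 / 2] for
     [d = |w - y|]. *)
  exists (c - `|k| * `|w - x0| - 2^-1 * `|k| ^+ 2)%R => s [y fs].
  have := le_trans (fck y) fs; rewrite lee_fin => h.
  have h1 : (`|y - x0| <= `|w - y| + `|w - x0|)%R.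
    by rewrite (distrC w y); exact: ler_distD.
  have h2 : (k * `|y - x0| <= `|k| * (`|w - y| + `|w - x0|))%R.
    apply: (le_trans (ler_norm _)).
    by rewrite normrM normr_id; apply: ler_wpM2l.
  have := sqr_ge0 (`|k| - `|w - y|)%R; rewrite sqrrB; lra.
have lA : has_inf A by split => //; exists l.
pose m := inf A.
have mA (s : R) y : f y <= (s - 2^-1 * `|w - y| ^+ 2)%:E -> (m <= s)%R.
  by move=> fys; apply: ge_inf; [case: lA | exists y].
have /choice[u uP] : forall n : nat, exists y,
    f y <= (m + n.+1%:R^-1 - 2^-1 * `|w - y| ^+ 2)%:E.
  move=> n; have n0 : (0 < n.+1%:R^-1 :> R)%R by rewrite invr_gt0.
  have [s [y fy] sm] := inf_adherent n0 lA; exists y.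
  by apply: (le_trans fy); rewrite lee_fin lerD2r ltW.
have half01 : (0 < (2^-1 : R) < 1)%R by lra.
(* The objective at the midpoint [y] of [u n] and [u n'] is at least [m]. The parallelogram law then
   bounds the squared distance by four times the sum of the two errors. *)
have uC n n' : (n <= n')%N -> (`|u n' - u n| ^+ 2 <= 8 * n.+1%:R^-1)%R.
  move=> nn'.
  have := econvex_le cf half01 (uP n) (uP n').
  set y := (_ *: u n + _)%R => fy.
  have := @mA (2^-1 * (m + n.+1%:R^-1) + 2^-1 * (m + n'.+1%:R^-1)
    - 8^-1 * `|u n' - u n| ^+ 2)%R y.
  have yE : (w - y = 2^-1 *: ((w - u n) + (w - u n')))%R.
    have half2 : (2^-1 + 2^-1 = 1 :> R)%R by lra.
    rewrite scalerDr !scalerBr addrACA -scalerDl half2 scale1r -opprD /y.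
    by congr (_ - (_ + _ *: _))%R; lra.
  have dE : (u n' - u n = (w - u n) - (w - u n'))%R.
    by rewrite opprB [RHS]addrC subrKA.
  have -> : ((2^-1 * (m + n.+1%:R^-1) + 2^-1 * (m + n'.+1%:R^-1)
      - 8^-1 * `|u n' - u n| ^+ 2) - 2^-1 * `|w - y| ^+ 2 =
    2^-1 * (m + n.+1%:R^-1 - 2^-1 * `|w - u n| ^+ 2)
      + (1 - 2^-1) * (m + n'.+1%:R^-1 - 2^-1 * `|w - u n'| ^+ 2))%R.
    rewrite yE dE sqr_normZ (sqr_normD (w - u n) (w - u n'))%R
      (sqr_normB (w - u n)%R).
    move: (n.+1%:R^-1)%R (n'.+1%:R^-1)%R => e e'; by field.
  move=> /(_ fy) h.
  have h2 : (n'.+1%:R^-1 <= n.+1%:R^-1 :> R)%R by rewrite lef_pV2 ?posrE// ler_nat ltnS.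
  move: (n.+1%:R^-1)%R (n'.+1%:R^-1)%R h h2 => e e'; lra.
have u_cvg : cvg (u @ \oo).
  apply: cvg_sqr_cauchy uC.
  rewrite -[0%R](mulr0 8%R); apply: cvgM; first exact: cvg_cst.
  exact: cvg_harmonic.
pose p := lim (u @ \oo).
have fp : f p <= (m - 2^-1 * `|w - p| ^+ 2)%:E.
  apply: (lsc_cvg_le lf u_cvg _ uP).
  apply: cvgB; last first.
    apply: cvgM; first exact: cvg_cst.
    by apply: cvg_sqr_norm; apply: cvgB => //; exact: cvg_cst.
  by rewrite -[X in _ --> X]addr0; apply: cvgD; [exact: cvg_cst|exact: cvg_harmonic].
have fpfin : f p \is a fin_num by rewrite fin_real// fNy (le_lt_trans fp)// ltry.
exists p => // y.
case fy : (f y) (fNy y) => [b| |] // _; last by rewrite leey.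
move: fp fpfin; case fpE : (f p) => [a| |] //; rewrite lee_fin => fp _.
rewrite -EFinD lee_fin -subr_ge0.
set X := (b - _)%R.
(* Minimality of [p] against the point [q] of the segment from [p] to [y], divided by [t]; as [t]
   tends to 0 this leaves the subgradient inequality. *)
have key (t : R) : (0 < t < 1)%R -> (0 <= X + t * (2^-1 * `|y - p| ^+ 2))%R.
  move=> t01.
  have fya : f y <= b%:E by rewrite fy.
  have fpa : f p <= a%:E by rewrite fpE.
  have := econvex_le cf t01 fya fpa; set q := (_ *: y + _)%R => fq.
  have := @mA (t * b + (1 - t) * a + 2^-1 * `|w - q| ^+ 2)%R q.
  rewrite addrK => /(_ fq).
  have -> : (w - q = (w - p) - t *: (y - p))%R.
    by rewrite /q scalerBl scale1r scalerBr [(t *: y + _)%R]addrCA opprD addrA.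
  rewrite sqr_normB innerZr sqr_normZ.
  case/andP: t01 => t0 t1 h.
  rewrite -(pmulr_rge0 _ t0) /X innerC.
  lra.
exact: ge0_of_small key.
Qed.
End Convex.

(** * Projections, Riesz representation, and minimization of suprema of affine functions *)

Definition convex_subset {R : realType} {H : hilbertType R} (C : set H) : Prop :=
  forall x y (t : R), (0 < t < 1)%R -> C x -> C y -> C (t *: x + (1 - t) *: y)%R.

Section Projection.
Context {R : realType} {H : hilbertType R}.
Implicit Types (C V : set H) (w x y p : H).

Lemma closed_convex_projection C w : closed C -> convex_subset C -> C !=set0 ->
  exists2 p, C p & forall y, C y -> (inner (y - p) (w - p) <= 0)%R.
Proof.
move=> clC cvC [c Cc].
(* For the indicator of [C], the subgradient inequality at the proximal point is the variational
   inequality of the projection. *)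
pose f x : \bar R := if `[< C x >] then 0 else +oo.
have fE x : C x -> f x = 0 by move=> Cx; rewrite /f asboolT.
have fC x : f x < +oo -> C x by rewrite /f; case: ifPn => [/asboolP|].
have f0 x : 0 <= f x by rewrite /f; case: ifPn.
have fNy x : -oo < f x by apply: lt_le_trans (f0 x).
have [||| p fp sp] := @prox_exists _ _ f w.
- move=> x a; rewrite /f; case: ifPn => [/asboolP Cx a0|/asboolPn nCx _].
    by exists setT => [|y _]; [exact: filterT|exact: lt_le_trans (f0 y)].
  exists (~` C); first by apply: open_nbhs_nbhs; split => //; rewrite openC.
  by move=> y nCy; rewrite asboolF// ltry.
- apply: le_econvex => // x y a b t t01 fa fb; have /andP[t0 t1] := t01.
  have a0 : (0 <= a)%R by rewrite -lee_fin (le_trans (f0 x)).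
  have b0 : (0 <= b)%R by rewrite -lee_fin (le_trans (f0 y)).
  have Cx : C x by apply: fC; apply: le_lt_trans fa (ltry _).
  have Cy : C y by apply: fC; apply: le_lt_trans fb (ltry _).
  by rewrite fE; [rewrite lee_fin; nra|exact: cvC].
- by split=> //; exists c; rewrite /edom/= fE// ltry.
have Cp : C p by apply: fC; rewrite ltey_eq fp.
by exists p => // y Cy; have := sp y; rewrite !fE// adde0 lee_fin.
Qed.

Lemma subspace_projection V w : closed V -> linear_subspace V ->
  exists2 p, V p & forall y, V y -> inner y (w - p)%R = 0%R.
Proof.
move=> clV [V0 VD].
have VZ (a : R) x : V x -> V (a *: x)%R.
  by move=> Vx; have := VD a x 0%R Vx V0; rewrite addr0.
have [||p Vp pP] := closed_convex_projection w clV.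
- by move=> x y t _ Vx Vy; apply: VD => //; exact: VZ.
- by exists 0%R.
exists p => // y Vy; apply/eqP; rewrite eq_le; apply/andP; split.
  (* Testing with [p + y] and then with [p - y] turns the inequality into orthogonality. *)
  have := pP (1 *: y + p)%R; rewrite scale1r addrK; apply.
  by rewrite -(scale1r y); exact: VD.
have := pP ((-1) *: y + p)%R; rewrite addrK scaleN1r innerNl oppr_le0; apply.
by rewrite -scaleN1r; exact: VD.
Qed.

Lemma riesz (l : {linear H -> R^o}) : continuous l ->
  exists u, forall x, l x = inner x u.
Proof.
move=> cl; pose f x := (- l x)%:E.
(* The minimizer [p] of [|x| ^ 2 / 2 - l x] represents [l]: the subgradient inequality gives
   [l x <= inner x p], and applying it to [- x] gives equality. *)
have [||| p _ sp] := @prox_exists _ _ f 0%R.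
- move=> x a; rewrite lte_fin => ax.
  have := cl x; move/cvgN => /cvgrPdist_lt.
  have d0 : (0 < - l x - a)%R by rewrite subr_gt0.
  move=> /(_ _ d0) h; exists [set y | `|- l x - - l y| < - l x - a]%R => //.
  move=> y /= hy; rewrite lte_fin.
  by have := le_lt_trans (ler_norm _) hy; rewrite ltrD2l ltrN2.
- move=> x y t _; rewrite /f linearD !linearZ/= -!EFinM -EFinD lee_fin.
  by rewrite /GRing.scale/= opprD -!mulrN.
- by split=> [x|]; [exact: ltNyr|exists 0%R; exact: ltry].
have lp x : (l x <= inner x p)%R.
  have := sp (x + p)%R; rewrite addrK sub0r innerNr lee_fin linearD/=.
  by rewrite opprD lerD2r lerN2.
exists p => x; apply/eqP; rewrite eq_le lp/=.
by have := lp (- x)%R; rewrite linearN innerNl lerN2.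
Qed.

Lemma bigcap_closed_convex (C : nat -> set H) (M : R) :
  (forall n, closed (C n)) -> (forall n, convex_subset (C n)) ->
  (forall n k, (n <= k)%N -> C k `<=` C n) ->
  (forall n, exists2 x, C n x & (`|x| <= M)%R) -> exists p, forall n, C n p.
Proof.
move=> clC cvC decC bC.
(* [u n] is the projection of 0 on [C n], hence its point of least norm. *)
have /choice[u uP] : forall n, exists p, C n p /\
    forall y, C n y -> (inner (y - p) (0 - p) <= 0)%R.
  move=> n; have [|p Cp pP] := closed_convex_projection 0%R (clC n) (cvC n).
    by have [x Cx _] := bC n; exists x.
  by exists p.
have uS n y : C n y -> (`|y - u n| ^+ 2 <= `|y| ^+ 2 - `|u n| ^+ 2)%R.
  move=> Cy; have := (uP n).2 _ Cy.
  rewrite sqr_normB sub0r innerNr innerDl innerNl inner_norm; lra.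
have uB n : (`|u n| ^+ 2 <= M ^+ 2)%R.
  have [x Cx xM] := bC n; have := uS n x Cx.
  have : (`|x| ^+ 2 <= M ^+ 2)%R by rewrite lerXn2r ?nnegrE// (le_trans _ xM).
  by have := sqr_ge0 (`|x - u n|)%R; lra.
have uk n k : (n <= k)%N -> (`|u k - u n| ^+ 2 <= `|u k| ^+ 2 - `|u n| ^+ 2)%R.
  by move=> nk; apply: uS; apply: decC nk _ _; exact: (uP k).1.
have und : nondecreasing_seq (fun n => `|u n| ^+ 2 : R)%R.
  move=> n k nk; rewrite -subr_ge0; apply: le_trans (uk _ _ nk).
  by rewrite sqr_ge0.
have uub : has_ubound (range (fun n => `|u n| ^+ 2 : R)%R).
  by exists (M ^+ 2)%R => _ [n _ <-].
have ucv := nondecreasing_cvgn und uub.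
set l := sup _ in ucv.
have u_cvg : cvg (u @ \oo).
  apply: (@cvg_sqr_cauchy _ _ _ (fun n => l - `|u n| ^+ 2)%R).
    by rewrite -[X in _ --> X](subrr l); apply: cvgB => //; exact: cvg_cst.
  move=> n k nk; apply: le_trans (uk _ _ nk) _; rewrite lerD2r.
  by apply: sup_upper_bound; [split => //;
    exists (`|u 0%N| ^+ 2)%R; exists 0%N | exists k].
exists (lim (u @ \oo)) => n;
apply: (@closed_cvg _ _ \oo eventually_filter u (C n) (clC n) _ _ u_cvg).
by exists n => // k /= nk; apply: decC nk _ _; exact: (uP k).1.
Qed.

(* Orthogonally to [V] the objective is constant, while [V = cone (range b)]
   makes the sublevel sets weakly, hence (Banach-Steinhaus) strongly, bounded
   in [V]. *)
Lemma affine_sup_argmin (T : Type) (a : T -> R) (b : T -> H) V (D : H -> \bar R) :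
  closed V -> linear_subspace V -> (forall t, V (b t)) ->
  (forall y, V y -> exists2 l : R, (0 < l)%R & exists t, y = (l *: b t)%R) ->
  (forall v (s : R), D v <= s%:E <-> forall t, (a t - inner v (b t) <= s)%R) ->
  argmin D !=set0.
Proof.
move=> clV Vlin Vb bV DP.
have [V0 VD] := Vlin.
(* A vanishing slope bounds the objective below by the constant [a t0]. *)
have [t0 bt0] : exists t, b t = 0%R.
  have [l l0 [t /esym/eqP]] := bV _ V0.
  by rewrite scaler_eq0 gt_eqF//= => /eqP bt; exists t.
have Dge v s : D v <= s%:E -> (a t0 <= s)%R.
  by move=> /DP /(_ t0); rewrite bt0 inner0r subr0.
have [[v0 Dv0]|noD] := pselect (exists v, D v < +oo); last first.
  exists 0%R => y; rewrite (_ : D y = +oo) ?leey//.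
  by apply/eqP; rewrite -leye_eq leNgt; apply/negP => Dy; apply: noD; exists y.
have D_le v : D v < +oo -> exists s : R, D v <= s%:E.
  by case: (D v) => [s| |]// _; [exists s|exists 0%R; exact: leNye].
pose A : set R := [set s : R | exists v, D v <= s%:E].
have Ainf : has_inf A.
  split; first by have [s Ds] := D_le _ Dv0; exists s, v0.
  by exists (a t0) => s [v]; exact: Dge.
pose m := inf A.
have mA v (s : R) : D v <= s%:E -> (m <= s)%R.
  by move=> Ds; apply: ge_inf; [exact: Ainf.2|exists v].
pose C n := [set v | D v <= (m + n.+1%:R^-1)%:E].
have [M MP] : exists M : R, forall v, V v -> D v <= (m + 1)%:E -> (`|v| <= M)%R.
  (* The sublevel set is seen as a family of functionals, to be bounded pointwise. *)
  pose F := [set inner v | v in [set v | V v /\ D v <= (m + 1)%:E]].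
  have : uniform_bounded (F : set (H -> R^o)).
    apply: Banach_Steinhauss => [_ [v _ <-]|x].
      by split; [exact: inner_bounded|exact: inner_linear].
    have [p Vp pP] := subspace_projection x clV Vlin.
    have [l l0 [t pt]] := bV _ Vp.
    (* Both [p] and [- p] are positive multiples of slopes, so [inner v p] is bounded on both
       sides. *)
    have VNp : V (- p)%R by have := VD (-1)%R p 0%R Vp V0; rewrite addr0 scaleN1r.
    have [l' l'0 [t' pt']] := bV _ VNp.
    exists (`|l * (m + 1 - a t)| + `|l' * (m + 1 - a t')|)%R.
    move=> _ [v [Vv /DP Dv] <-].
    have -> : inner v x = inner v p.
      by apply/eqP; rewrite -subr_eq0 -innerNr -innerDr pP.
    have h1 : (- inner v p <= l * (m + 1 - a t))%R.
      by rewrite pt innerZr -mulrN ler_pM2l//; have := Dv t; lra.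
    have h2 : (inner v p <= l' * (m + 1 - a t'))%R.
      by rewrite -[p]opprK innerNr pt' innerZr -mulrN ler_pM2l//; have := Dv t'; lra.
    have h3 := ler_norm (l * (m + 1 - a t))%R.
    have h4 := ler_norm (l' * (m + 1 - a t'))%R.
    have h5 := normr_ge0 (l * (m + 1 - a t))%R.
    have h6 := normr_ge0 (l' * (m + 1 - a t'))%R.
    by rewrite ler_norml; apply/andP; split; lra.
  move=> /(_ 1%R)[M FM]; exists M => v Vv Dv.
  (* At the unit vector along [v], the functional takes the value [|v|]. *)
  have /FM /(_ (`|v|^-1 *: v)%R) : F (inner v) by exists v.
  have [->|v0'] := eqVneq v 0%R.
    by rewrite scaler0 inner0l !normr0 ler01 => /(_ isT).
  rewrite normrZ normfV normr_id mulVf ?normr_eq0// lexx => /(_ isT).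
  by rewrite innerZr inner_norm expr2 mulKf ?normr_eq0// normr_id.
have [p Cp] : exists p, forall n, C n p.
  apply: (@bigcap_closed_convex C M).
  - move=> n; rewrite (_ : C n =
      \bigcap_t [set v | (a t - inner v (b t) <= m + n.+1%:R^-1)%R]).
      apply: closed_bigI => t _.
      rewrite (_ : [set v | _] = inner (b t) @^-1`
        [set s | (a t - (m + n.+1%:R^-1) <= s)%R]); last first.
        by apply/seteqP; split => v /=; rewrite innerC; move: (n.+1%:R^-1)%R => e; lra.
      apply: closed_comp => [v _|]; last exact: closed_ge.
      exact: cvg_inner.
    by apply/seteqP; split => v; [move=> /DP Dv t _; exact: Dv|
      move=> Dv; apply/DP => t; exact: (Dv t Logic.I)].
  - move=> n x y t /andP[t_0 t_1] /DP Dx /DP Dy; apply/DP => i.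
    have := Dx i; have := Dy i; rewrite innerDl !innerZl.
    move: (n.+1%:R^-1)%R => e; nra.
  - move=> n k nk v /le_trans; apply; rewrite lee_fin lerD2l.
    by rewrite lef_pV2 ?posrE// ler_nat ltnS.
  - move=> n; have n0 : (0 < n.+1%:R^-1 :> R)%R by rewrite invr_gt0.
    have [s [v Dv] sm] := inf_adherent n0 Ainf.
    (* Projecting an almost minimizer on [V] leaves the objective unchanged and makes the bound [M]
       available. *)
    have [p Vp pP] := subspace_projection v clV Vlin.
    have Cp : C n p.
      apply/DP => t; have /DP/(_ t) := Dv.
      have : inner v (b t) = inner p (b t).
        by apply/eqP; rewrite -subr_eq0 -innerNl -innerDl innerC pP.
      by move=> ->; move/le_trans; apply; exact: ltW.
    exists p => //; apply: MP => //; apply: (le_trans Cp).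
    by rewrite lee_fin lerD2l invf_le1// ler1n.
exists p => y.
case Dy : (D y) => [s| |]; last 2 first.
- exact: leey.
- by have := Dge y (a t0 - 1)%R; rewrite Dy leNye lerBrDr gerDl ler10 => /(_ isT).
have ms : (m <= s)%R by apply: (mA y); rewrite Dy.
apply/DP => t; rewrite leNgt; apply/negP => h.
have e0 : (0 < a t - inner p (b t) - s)%R by rewrite subr_gt0.
have [N _ /(_ N (leqnn N))] := near_infty_natSinv_lt (PosNum e0).
have /DP/(_ t) := Cp N; move: (N.+1%:R^-1)%R => /= e; lra.
Qed.

End Projection.

(** * Conjugates and Moreau envelopes *)

Section Conjugate.
Context {R : realType} {H : hilbertType R}.
Implicit Types (f g : H -> \bar R) (x y z p r u v w h : H) (a b s : R).

(** The conjugate as a supremum over the epigraph of [f], which involves real numbers only. *)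
Lemma conjugate_leP f u s : (forall x, -oo < f x) ->
  conjugate f u <= s%:E <->
  forall x a, f x <= a%:E -> (inner x u - a <= s)%R.
Proof.
move=> fNy; split=> [fus x a fa|fus].
  rewrite -lee_fin EFinB; apply: le_trans fus.
  apply: le_trans (ereal_sup_ubound _); last by exists x.
  exact: leeB.
apply: ge_ereal_sup => _ [x _ <-].
case fx : (f x) (fNy x) => [a| |] // _; last by rewrite leNye.
by rewrite -EFinB lee_fin; apply: fus; rewrite fx.
Qed.

Lemma conjugate_ge f x u a : f x <= a%:E ->
  (inner x u - a)%:E <= conjugate f u.
Proof.
move=> fa; apply: le_trans (ereal_sup_ubound _); last by exists x.
by rewrite EFinB; exact: leeB.
Qed.

Lemma proper_fin f : proper_fun f -> exists x a, f x = a%:E.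
Proof.
move=> [fNy [x fx]]; exists x, (fine (f x)).
by rewrite fineK// fin_real// fNy.
Qed.

Lemma conjugate_subdiff f p u a : (forall x, -oo < f x) ->
  f p = a%:E -> subdiff f p u -> conjugate f u = (inner p u - a)%:E.
Proof.
move=> fNy fp sp; apply/eqP; rewrite eq_le conjugate_ge ?fp// andbT.
apply/conjugate_leP => // x b fb.
have := le_trans (sp x) fb; rewrite fp -EFinD lee_fin innerDl innerNl; lra.
Qed.

(** The proximal point of 0 carries a subgradient, and the conjugate is finite there by the
    Fenchel-Young equality. *)
Lemma conjugate_proper f : lower_semicontinuous f -> econvex f ->
  proper_fun f -> proper_fun (conjugate f).
Proof.
move=> lf cf pf; have [x0 [a0 fx0]] := proper_fin pf; split=> [u|].
  have fa : f x0 <= a0%:E by rewrite fx0.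
  by apply: lt_le_trans (conjugate_ge u fa); exact: ltNyr.
have [p fp sp] := prox_exists 0%R lf cf pf.
exists (0 - p)%R; rewrite /edom/=.
have fpE : f p = (fine (f p))%:E by rewrite fineK.
by rewrite (conjugate_subdiff pf.1 fpE sp) ltry.
Qed.

Lemma conjugate_convex f : (forall x, -oo < f x) -> forall x y a b (t : R),
  (0 < t < 1)%R -> conjugate f x <= a%:E -> conjugate f y <= b%:E ->
  conjugate f (t *: x + (1 - t) *: y)%R <= (t * a + (1 - t) * b)%:E.
Proof.
move=> fNy x y a b t /andP[t0 t1] /(conjugate_leP _ _ fNy) fx.
move=> /(conjugate_leP _ _ fNy) fy; apply/conjugate_leP => // z c fz.
have := fx _ _ fz; have := fy _ _ fz; rewrite innerDr !innerZr; nra.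
Qed.

Lemma conjugate_shift f r v :
  conjugate (fun y => f (y - r)%R) v = conjugate f v + (inner v r)%:E.
Proof.
apply/eqP; rewrite eq_le; apply/andP; split.
  apply: ge_ereal_sup => _ [y _ <-].
  have -> : inner y v = (inner (y - r) v + inner v r)%R.
    by rewrite (innerC v) -innerDl subrK.
  rewrite EFinD addeAC leeD2r//; apply: ereal_sup_ubound.
  by exists (y - r)%R.
rewrite -leeBrDr//; apply: ge_ereal_sup => _ [y _ <-].
rewrite leeBrDr//; apply: le_trans (ereal_sup_ubound _); last first.
  by exists (y + r)%R.
by rewrite addrK innerDl EFinD addeAC (innerC r).
Qed.

(** Fenchel-Young inequality for [conjugate f y], then completion of the square in [(w - y) - x]. *)
Lemma moreau_env_conjugate_ge f x w a : f x <= a%:E ->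
  (inner x w - a - 2^-1 * `|x| ^+ 2)%:E <= moreau_env (conjugate f) w.
Proof.
move=> fa; apply: le_ereal_inf_tmp => _ [y _ <-]; rewrite /prox_objective.
apply: le_trans (leeD2r _ (conjugate_ge y fa)); rewrite -EFinD lee_fin.
have := sqr_ge0 (`|(w - y) - x|)%R.
rewrite (sqr_normB (w - y)%R x) innerDl innerNl !(innerC x); lra.
Qed.

(** Moreau decomposition: the infimum defining the envelope is attained at [w - p]. *)
Lemma moreau_env_conjugateE f p w a : (forall x, -oo < f x) ->
  f p = a%:E -> subdiff f p (w - p)%R ->
  moreau_env (conjugate f) w = (inner p w - a - 2^-1 * `|p| ^+ 2)%:E.
Proof.
move=> fNy fp sp; apply/eqP; rewrite eq_le moreau_env_conjugate_ge ?fp//.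
rewrite andbT; apply: le_trans (ereal_inf_lbound _) _.
  by exists (w - p)%R.
rewrite /prox_objective (conjugate_subdiff fNy fp sp) -EFinD lee_fin.
by rewrite subKr innerDr innerNr inner_norm; lra.
Qed.

Section Closed.
Variables (f : H -> \bar R).
Hypotheses (lf : lower_semicontinuous f) (cf : econvex f) (pf : proper_fun f).

Lemma prox_spec w : exists2 a, f (prox f w) = a%:E &
  subdiff f (prox f w) (w - prox f w)%R.
Proof.
have [p fp sp] := prox_exists w lf cf pf.
by rewrite (proxE fp sp); exists (fine (f p)); rewrite ?fineK.
Qed.

(* The envelope of [conjugate f] is differentiable with gradient [prox f]. *)
Lemma moreau_env_conjugate_grad w h : exists e e',
  [/\ moreau_env (conjugate f) w = e%:E,
      moreau_env (conjugate f) (w + h)%R = e'%:E &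
      (e + inner (prox f w) h <= e' <=
         e + inner (prox f w) h + 2^-1 * `|h| ^+ 2)%R].
Proof.
have [a fp sp] := prox_spec w; have [b fq sq] := prox_spec (w + h)%R.
have ew := moreau_env_conjugateE pf.1 fp sp.
have ewh := moreau_env_conjugateE pf.1 fq sq.
have fpa : f (prox f w) <= a%:E by rewrite fp.
have := moreau_env_conjugate_ge (w + h)%R fpa; rewrite ewh lee_fin => eh.
have := sp (prox f (w + h)%R); rewrite fp fq -EFinD lee_fin.
move: ew ewh eh; set p := prox f w; set q := prox f (w + h)%R.
move=> ew ewh eh pq; exists (inner p w - a - 2^-1 * `|p| ^+ 2)%R.
exists (inner q (w + h) - b - 2^-1 * `|q| ^+ 2)%R; split => //.
(* The lower bound is [eh]. For the upper one, [pq] leaves [inner (q - p) h - |q - p| ^ 2 / 2],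
   which this square bounds by [|h| ^ 2 / 2]. *)
have := sqr_ge0 (`|(q - p) - h|)%R; move: eh pq.
rewrite !sqr_normB !innerE -!inner_norm => eh pq hh.
by apply/andP; split; lra.
Qed.

End Closed.

Lemma conjugate_add_sqr f z u : lower_semicontinuous f -> econvex f ->
  proper_fun f ->
  conjugate (fun x => f x + (2^-1 * `|x - z| ^+ 2)%:E) u =
  moreau_env (conjugate f) (z + u)%R - (2^-1 * `|z| ^+ 2)%:E.
Proof.
move=> lf cf pf; have [a fp sp] := prox_spec lf cf pf (z + u)%R.
rewrite (moreau_env_conjugateE pf.1 fp sp).
move: fp sp; set p := prox f _ => fp sp.
apply/eqP; rewrite eq_le -EFinB; apply/andP; split.
  apply/conjugate_leP => [x|x b].
    by case: (f x) (pf.1 x) => //= r _; rewrite -EFinD ltNyr.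
  case fx : (f x) (pf.1 x) => [c| |] // _; rewrite -EFinD lee_fin => cb.
  have := sp x; rewrite fx fp -EFinD lee_fin.
  have := sqr_ge0 (`|x - p|)%R; move: cb.
  by rewrite !sqr_normB !innerE -!inner_norm; lra.
apply: le_trans (conjugate_ge u (_ : _ <= (a + 2^-1 * `|p - z| ^+ 2)%:E)).
  by rewrite lee_fin sqr_normB innerDr; lra.
by rewrite fp.
Qed.

Lemma lower_semicontinuous_add f (q : H -> R) :
  lower_semicontinuous f -> continuous q ->
  lower_semicontinuous (fun x => f x + (q x)%:E).
Proof.
move=> lf cq x a.
(* The level is split as [a = c + (a - c)], with [c] below [f x] and [a - c] below [q x]. When [f x]
   is [-oo] the premise is false and [c] is arbitrary. *)
have [c] : exists c : R, a%:E < f x + (q x)%:E -> c%:E < f x /\ (a - q x < c)%R.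
  case: (f x) => [b| |].
  - exists ((a - q x + b) / 2)%R; rewrite -EFinD !lte_fin; lra.
  - by exists (a - q x + 1)%R => _; split; [exact: ltry|rewrite ltrDl].
  - by exists 0%R; rewrite addNye ltNge leNye.
move=> h /h[cf ac]; have [V Vx cV] := lf _ _ cf.
have : \forall y \near x, (a - c < q y)%R.
  have d0 : (0 < q x - (a - c))%R by lra.
  have /cvgrPdist_lt/(_ _ d0) := cq x; apply: filterS => y /= hy.
  have := le_lt_trans (ler_norm _) hy; lra.
move=> qV; exists (V `&` [set y | (a - c < q y)%R]); first exact: filterI.
move=> y [Vy /= ay].
have -> : a = (c + (a - c))%R by lra.
by rewrite EFinD; apply: lteD; [exact: cV|rewrite lte_fin].
Qed.

Lemma continuous_half_sqr_norm z :
  continuous (fun x : H => 2^-1 * `|x - z| ^+ 2)%R.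
Proof.
move=> x; apply: cvgM; first exact: cvg_cst.
by apply: cvg_sqr_norm; apply: cvgB => //; exact: cvg_cst.
Qed.

Lemma econvex_add_sqr f z : (forall x, -oo < f x) -> econvex f ->
  econvex (fun x => f x + (2^-1 * `|x - z| ^+ 2)%:E).
Proof.
move=> fNy cf; apply: le_econvex => [x|x y a b t t01].
  by case: (f x) (fNy x) => //= r _; rewrite -EFinD ltNyr.
rewrite -!leeBrDr// -!EFinB => fa fb.
apply: le_trans (econvex_le cf t01 fa fb) _; rewrite lee_fin.
have -> : (t *: x + (1 - t) *: y - z = t *: (x - z) + (1 - t) *: (y - z))%R.
  by rewrite !scalerBr addrACA -opprD -scalerDl (addrC t) subrK scale1r.
(* In terms of [d = x - y] and [e = y - z], the convexity gap of the quadratic term is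
   [t * (1 - t) * |d| ^ 2 / 2]. *)
have -> : (x - z = (x - y) + (y - z))%R by rewrite subrKA.
move: (x - y)%R (y - z)%R => d e.
have -> : (t *: (d + e) + (1 - t) *: e = t *: d + e)%R.
  by rewrite scalerDr -addrA -scalerDl (addrC t) subrK scale1r.
rewrite !sqr_normD sqr_normZ innerZl; have := sqr_ge0 `|d|%R.
case/andP: t01 => t0 t1; nra.
Qed.

Lemma lower_semicontinuous_shift f r : lower_semicontinuous f ->
  lower_semicontinuous (fun y => f (y - r)%R).
Proof.
move=> lf x a /lf[V Vx aV]; exists [set y | V (y - r)%R] => [|y]; last exact: aV.
have c : (fun y : H => y - r)%R @ x --> (x - r)%R.
  by apply: cvgB => //; exact: cvg_cst.
exact: c.
Qed.

Lemma econvex_shift f r : econvex f -> econvex (fun y => f (y - r)%R).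
Proof.
move=> cf x y t t01.
have -> : (t *: x + (1 - t) *: y - r = t *: (x - r) + (1 - t) *: (y - r))%R.
  by rewrite !scalerBr addrACA -opprD -scalerDl (addrC t) subrK scale1r.
exact: cf.
Qed.

End Conjugate.

(** * Linear spans and their closures *)

Section Subspaces.
Context {R : realType} {H : hilbertType R}.
Implicit Types (A : set H).

Lemma linear_subspace_span A : linear_subspace (lin_span A).
Proof.
split=> [B [[B0 _] _]//|a x y Ax Ay B BP].
by apply: BP.1.2; [exact: Ax|exact: Ay].
Qed.

Lemma linear_subspace_closure A :
  linear_subspace A -> linear_subspace (closure A).
Proof.
move=> [A0 AD]; split=> [|a x y Ax Ay B nB]; first exact: subset_closure.
have c : (fun p : H * H => a *: p.1 + p.2)%R @ nbhs (x, y) --> (a *: x + y)%R.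
  by apply: cvgD; [apply: cvgZl_tmp; exact: cvg_fst|exact: cvg_snd].
have [[U V] /= [xU yV] UV] := c _ nB.
have [x' [Ax' Ux']] := Ax _ xU; have [y' [Ay' Vy']] := Ay _ yV.
by exists (a *: x' + y')%R; split; [exact: AD|exact: (UV (x', y'))].
Qed.

End Subspaces.

(** * The adjoint operator *)

Section Adjoint.
Context {R : realType} {H G : hilbertType R}.
Variable (L : {linear H -> G}).
Hypothesis L_bounded : bounded_near L (nbhs (0%R : H)).

(** Riesz representation of [inner v (L x)] as a function of [x] rules out the default value in
    [adjoint]. *)
Lemma inner_adjoint x v : inner (L x) v = inner x (adjoint L v).
Proof.
have lin : linear (fun x => inner v (L x) : R^o).
  by move=> a y z; rewrite linearP innerDr innerZr.
pose l : {linear H -> R^o} :=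
  HB.pack (fun x => inner v (L x) : R^o) (GRing.isLinear.Build _ _ _ _ _ lin).
have cl : continuous l.
  by move=> y; apply: cvg_inner; exact: (bounded_linear_continuous L_bounded).
have [u uP] := riesz cl.
rewrite /adjoint; case: xgetP => [w _ wP|/(_ u)[]]; first exact: wP.
by move=> y; rewrite innerC -uP.
Qed.

Lemma adjoint_linear : linear (adjoint L).
Proof.
move=> a v w; apply/eqP; rewrite -subr_eq0 -normr_eq0 -sqrf_eq0 -inner_norm.
rewrite innerDr innerNr innerDr innerZr -!inner_adjoint innerDr innerZr.
by rewrite subrr.
Qed.

End Adjoint.

(** * The dual problem: identification, existence and characterization of solutions *)

Section Dual.
Context {R : realType} {H G : hilbertType R}.
Variables (z : H) (r : G) (f : H -> \bar R) (g : G -> \bar R).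
Variable (L : {linear H -> G}).
Hypotheses (f_lsc : lower_semicontinuous f) (f_convex : econvex f).
Hypotheses (g_lsc : lower_semicontinuous g) (g_convex : econvex g).
Hypotheses (f_proper : proper_fun f) (g_proper : proper_fun g).
Hypothesis L_bounded : bounded_near L (nbhs (0%R : H)).

Local Notation D := (dual_objective f g L z r).

Lemma dual_problem : is_dual_of
  (fun x => f x + (2^-1 * `|x - z| ^+ 2)%:E) (fun y => g (y - r)%R) L
  (primal_objective f g L z r) D.
Proof.
split => //.
- split; last exact: econvex_add_sqr f_proper.1 f_convex.
    split=> [x|]; first by case: (f x) (f_proper.1 x) => //= a _; rewrite -EFinD ltNyr.
    have [x [a fx]] := proper_fin f_proper.
    by exists x; rewrite /edom/= fx -EFinD ltry.
  apply: lower_semicontinuous_add => //; exact: continuous_half_sqr_norm.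
- split; [|exact: lower_semicontinuous_shift|exact: econvex_shift].
  split=> [y|]; first exact: g_proper.1.
  have [y [b gy]] := proper_fin g_proper.
  by exists (y + r)%R; rewrite /edom/= addrK gy ltry.
- by exists 0%R => x; rewrite adde0 /primal_objective addeAC.
(* The additive constant is the one left by the Moreau identity. *)
- exists (2^-1 * `|z| ^+ 2)%R => v.
  rewrite /dual_objective conjugate_shift conjugate_add_sqr//.
  by rewrite [RHS]addeAC subeK// addeA.
Qed.

(* [D] is the supremum, over the product of the epigraphs, of affine functions
   whose slopes fill [L (dom f) - dom g - r]. *)
Lemma dual_objective_leP v (s : R) : D v <= s%:E <->
  forall x a y b, f x <= a%:E -> g y <= b%:E ->
  (inner x z - a - 2^-1 * `|x| ^+ 2 - b - inner v (L x - y - r) <= s)%R.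
Proof.
have [a fp sp] := prox_spec f_lsc f_convex f_proper (z - adjoint L v)%R.
have eE := moreau_env_conjugateE f_proper.1 fp sp.
rewrite /dual_objective eE addeAC -EFinD -leeBrDl// -EFinB.
split=> [/(conjugate_leP _ _ g_proper.1) gv x c y b fx gy|Dv].
  have := gv _ _ gy; have := moreau_env_conjugate_ge (z - adjoint L v)%R fx.
  rewrite eE lee_fin innerDr innerNr -inner_adjoint// => h1 h2.
  by move: h1 h2; rewrite !innerE !(innerC v); lra.
apply/(conjugate_leP _ _ g_proper.1) => y b gy.
(* At the proximal point the envelope value is attained, so this choice of [x] recovers the bound on
   the conjugate of [g]. *)
have fpa : f (prox f (z - adjoint L v)%R) <= a%:E by rewrite fp.
have := Dv _ _ _ _ fpa gy.
rewrite !innerDr !innerNr -!inner_adjoint// !(innerC v); lra.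
Qed.

Lemma dual_solution_exists : sri (set_sub (L @` edom f) (edom g)) r ->
  argmin D !=set0.
Proof.
move=> [_ coneE].
set K := set_sub _ [set r] in coneE.
pose T := {t : (H * R) * (G * R) |
             f t.1.1 <= t.1.2%:E /\ g t.2.1 <= t.2.2%:E}.
pose a (t : T) := let: ((x, a), (y, b)) := sval t in
  (inner x z - a - 2^-1 * `|x| ^+ 2 - b)%R.
pose b (t : T) := let: ((x, a), (y, b)) := sval t in (L x - y - r)%R.
apply: (@affine_sup_argmin _ _ T a b (closure (lin_span K))).
- exact: closed_closure.
- exact/linear_subspace_closure/linear_subspace_span.
- move=> [[[x c] [y d]] /= [fx gy]].
  have Kt : K (L x - y - r)%R.
    exists (L x - y)%R; last by exists r.
    exists (L x); first by exists x => //; exact: le_lt_trans fx (ltry _).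
    by exists y => //; exact: le_lt_trans gy (ltry _).
  by apply: subset_closure; exact: sub_gen_smallest Kt.
(* The strong relative interior condition makes every point of the closed span a positive multiple
   of a slope. *)
- move=> y; rewrite -coneE => -[l /= l0 [_ [_ [_ [x fx <-] [w gw <-]] [_ -> <-]] <-]].
  have fxa : f x <= (fine (f x))%:E by rewrite fineK// fin_real// f_proper.1.
  have gwb : g w <= (fine (g w))%:E by rewrite fineK// fin_real// g_proper.1.
  by exists l => //; exists (exist _ ((x, fine (f x)), (w, fine (g w))) (conj fxa gwb)).
- move=> v s; rewrite dual_objective_leP; split=> h.
    by move=> [[[x c] [y d]] /= [fx gy]]; exact: h.
  by move=> x c y d fx gy; exact: (h (exist _ ((x, c), (y, d)) (conj fx gy))).
Qed.

Lemma dual_solutionP v : argmin D v <->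
  subdiff (conjugate g) v (L (prox f (z - adjoint L v)%R) - r)%R.
Proof.
have [gNy [v1 gv1]] := conjugate_proper g_lsc g_convex g_proper.
set p := prox f _.
have adjB y (t : R) : (z - adjoint L (t *: y + (1 - t) *: v) =
    z - adjoint L v + - t *: adjoint L (y - v))%R.
  have -> : (t *: y + (1 - t) *: v = t *: (y - v) + v)%R.
    by rewrite scalerBl scale1r scalerBr addrCA addrC.
  by rewrite adjoint_linear// opprD addrCA addrC scaleNr.
(* First-order expansion of the envelope term from [v] towards [y], with a remainder quadratic in
   [t]. *)
have DE y (t : R) : exists e e' : R,
    [/\ forall s, conjugate g v = s%:E -> D v = (e + s + inner v r)%:E,
     D (t *: y + (1 - t) *: v)%R =
       e'%:E + conjugate g (t *: y + (1 - t) *: v)%R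
       + (inner (t *: y + (1 - t) *: v)%R r)%:E,
      (e - t * inner (y - v) (L p) <= e')%R &
      (e' <= e - t * inner (y - v) (L p)
        + t ^+ 2 * (2^-1 * `|adjoint L (y - v)| ^+ 2))%R].
  have [e [e' [eE e'E]]] := moreau_env_conjugate_grad f_lsc f_convex f_proper
    (z - adjoint L v)%R (- t *: adjoint L (y - v))%R.
  rewrite -/p innerZr -inner_adjoint// (innerC (L p)) sqr_normZ => /andP[h1 h2].
  exists e, e'; split; [|by rewrite /dual_objective adjB e'E|lra|lra].
  by move=> s gs; rewrite /dual_objective eE gs -!EFinD.
split=> [vmin y|vsub y].
  have [d1 gv1E] : exists d, conjugate g v1 = d%:E.
    by exists (fine (conjugate g v1)); rewrite fineK// fin_real// gNy.
  (* Comparison with [v1], where the conjugate of [g] is finite, forces it to be finite at the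
     minimizer [v]. *)
  have Dv1 : D v < +oo.
    apply: le_lt_trans (vmin v1) _.
    have [e [e' [_ + _ _]]] := DE v1 1%R.
    by rewrite subrr scale0r addr0 scale1r gv1E -!EFinD => ->; rewrite ltry.
  have [c gv] : exists c, conjugate g v = c%:E.
    exists (fine (conjugate g v)); rewrite fineK// fin_real// gNy/= ltNge leye_eq.
    apply/eqP => gvy; move: Dv1; rewrite /dual_objective gvy.
    have [e [_ [-> _ _]]] := moreau_env_conjugate_grad f_lsc f_convex f_proper
      (z - adjoint L v)%R 0%R.
    by rewrite addey// addye// ltxx.
  case gy : (conjugate g y) (gNy y) => [d| |] // _; last by rewrite leey.
  rewrite gv -EFinD lee_fin -subr_ge0.
  (* Minimality along the segment and convexity of the conjugate give the subgradient inequality up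
     to an error of order [t]. *)
  apply: (@ge0_of_small _ _ (2^-1 * `|adjoint L (y - v)| ^+ 2)%R) => t t01.
  have [e [e' [/(_ _ gv) Dv Dq _ e'le]]] := DE y t.
  have gyd : conjugate g y <= d%:E by rewrite gy.
  have gvc : conjugate g v <= c%:E by rewrite gv.
  have gq := conjugate_convex g_proper.1 t01 gyd gvc.
  have := vmin (t *: y + (1 - t) *: v)%R; rewrite Dv Dq.
  move=> /le_trans /(_ (leeD2r _ (leeD2l _ gq))); rewrite -!EFinD lee_fin.
  case/andP: t01 => t0 t1; rewrite innerDl !innerZl => h.
  rewrite -(pmulr_rge0 _ t0).
  move: h e'le; rewrite !innerE; nra.
have [c gv] : exists c, conjugate g v = c%:E.
  exists (fine (conjugate g v)); rewrite fineK// fin_real// gNy/= ltNge leye_eq.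
  apply/eqP => gvy; have := vsub v1; rewrite gvy addey// => h.
  by move: gv1; rewrite /edom/= ltNge h.
(* With [t = 1] the moving point is [y]; the gradient inequality for the envelope and the inclusion
   for the conjugate add up to minimality. *)
have [e [e' [/(_ _ gv) -> + e'ge _]]] := DE y 1%R.
rewrite subrr scale0r addr0 scale1r => ->.
have := vsub y; rewrite gv.
case: (conjugate g y) (gNy y) => [d| |] // _; last first.
  by move=> _; rewrite addey// addye// leey.
by rewrite -!EFinD !lee_fin; move: e'ge; rewrite !innerE; lra.
Qed.

End Dual.

Theorem proposition3p3 (R : realType) (H G : hilbertType R) (z : H) (r : G)
    (f : H -> \bar R) (g : G -> \bar R) (L : {linear H -> G})
    (f_gtNy : forall x, -oo < f x) (f_lsc : lower_semicontinuous f)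
    (f_convex : econvex f)
    (g_gtNy : forall y, -oo < g y) (g_lsc : lower_semicontinuous g)
    (g_convex : econvex g)
    (L_bounded : bounded_near L (nbhs (0%R : H)))
    (L_neq0 : exists x, L x != 0%R)
    (r_sri : sri (set_sub (L @` edom f) (edom g)) r) :
  [/\ is_dual_of
        (fun x => f x + (2^-1 * `|x - z| ^+ 2)%:E) (fun y => g (y - r)%R) L
        (primal_objective f g L z r) (dual_objective f g L z r),
      argmin (dual_objective f g L z r) !=set0
    & forall v : G, argmin (dual_objective f g L z r) v <->
        subdiff (conjugate g) v (L (prox f (z - adjoint L v)%R) - r)%R].
Proof.
(* As a point of the set itself, [r] provides points of both domains, whence properness. *)
have [[_ [x fx _] [y gy _]] _] := r_sri.
have f_proper : proper_fun f by split => //; exists x.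
have g_proper : proper_fun g by split => //; exists y.
split; first exact: dual_problem.
  exact: dual_solution_exists.
by move=> v; exact: dual_solutionP.
Qed.
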